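(* The functor $Ext_g:\mathbf{Graded\ Fuzzy\ TopSys}\longrightarrow\mathbf{Graded\ Fuzzy\ Top}$ is the right adjoint to the functor $J_g:\mathbf{Graded\ Fuzzy\ Top}\longrightarrow\mathbf{Graded\ Fuzzy\ TopSys}$.
   Context: Conventions. On $[0,1]$, $\wedge$ is minimum; infima and suprema of grades are taken in $[0,1]$. The Gödel arrow is $a\rightarrow b=1$ if $a\le b$ and $a\rightarrow b=b$ if $a>b$, for $a,b\in[0,1]$. A fuzzy subset of a set $X$ is a map $X\to[0,1]$. Spaces. A fuzzy topological space with graded inclusion $(X,\tau,\subseteq)$ is a set $X$ with a collection $\tau$ of fuzzy subsets of $X$ containing the constants $\tilde\emptyset=0$ and $\tilde X=1$, closed under arbitrary pointwise suprema (written $\bigcup$) and binary pointwise minima (written $\cap$), together with the fuzzy inclusion relation $gr(\tilde T_1\subseteq\tilde T_2)=\inf_{x\in X}\{\tilde T_1(x)\rightarrow\tilde T_2(x)\}$. The category $\mathbf{Graded\ Fuzzy\ Top}$ has these as objects; a morphism $f:(X,\tau,\subseteq)\to(Y,\tau',\subseteq)$ is a function $f:X\to Y$ such that $f^{-1}(\tilde T')\in\tau$ for all $\tilde T'\in\tau'$, where $f^{-1}(\tilde T')(x)=\tilde T'(f(x))$. Composition and identities are those of functions. Graded frames. A graded frame $(A,R)$ is a tuple $(A,\top,\wedge,\bigvee,R)$ with $A$ a non-empty set, $\top\in A$, $\wedge$ a binary operation on $A$, $\bigvee$ an operation on arbitrary subsets of $A$, and $R:A\times A\to[0,1]$ a fuzzy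 relation, such that for all $a,b,c\in A$, $S\subseteq A$: (1) $R(a,a)=1$; (2) $R(a,b)=1=R(b,a)$ implies $a=b$; (3) $R(a,b)\wedge R(b,c)\le R(a,c)$; (4) $R(a\wedge b,a)=1=R(a\wedge b,b)$; (5) $R(a,\top)=1$; (6) $R(a,b)\wedge R(a,c)=R(a,b\wedge c)$; (7) $R(a,\bigvee S)=1$ if $a\in S$; (8) $\inf\{R(a,b)\mid a\in S\}=R(\bigvee S,b)$; (9) $R(a\wedge\bigvee S,\bigvee\{a\wedge b\mid b\in S\})=1$. A graded frame homomorphism $f:(A,R)\to(B,R')$ is a map $f:A\to B$ with (i) $f(a_1\wedge a_2)=f(a_1)\wedge f(a_2)$; (ii) $f(\bigvee_i a_i)=\sup_i\{f(a_i)\}$, where $\sup$ is the join in $B$; (iii) $R(a_1,a_2)\le R'(f(a_1),f(a_2))$. Systems. A graded fuzzy topological system $(X,\models,A,R)$ consists of a nonempty set $X$, a graded frame $(A,R)$ and a fuzzy relation $\models$ from $X$ to $A$, with values $gr(x\models a)\in[0,1]$, such that: (1) $gr(x\models a)\wedge R(a,b)\le gr(x\models b)$; (2) $gr(x\models\bigwedge S)=\inf\{gr(x\models a)\mid a\in S\}$ for every finite subset $S$ of $A$, including the empty set; (3) $gr(x\models\bigvee S)=\sup\{gr(x\models a)\mid a\in S\}$ for every $S\subseteq A$. The category $\mathbf{Graded\ Fuzzy\ TopSys}$ has these as objects; a morphism $(f_1,f_2):(X,\models,A,R)\to(Y,\models',B,R')$ consists of a function $f_1:X\to Y$ and a graded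 frame homomorphism $f_2:(B,R')\to(A,R)$ with $gr(x\models f_2(b))=gr(f_1(x)\models' b)$ for all $x\in X$, $b\in B$. Identities are $(id_X,id_A)$ and composition is $(g_1,g_2)\circ(f_1,f_2)=(g_1\circ f_1,f_2\circ g_2)$. Functors. For a system $(X,\models,A,R)$ and $a\in A$, let $ext_g(a):X\to[0,1]$, $ext_g(a)(x)=gr(x\models a)$, and $ext_g(A)=\{ext_g(a)\mid a\in A\}$. Then $Ext_g(X,\models,A,R)=(X,ext_g(A),\subseteq)$ and $Ext_g(f_1,f_2)=f_1$. Also $J_g(X,\tau,\subseteq)=(X,\in,\tau,\subseteq)$, where $gr(x\in\tilde T)=\tilde T(x)$ for $\tilde T\in\tau$ and $\tau$ is the graded frame with top $\tilde X$, meet $\cap$, join $\bigcup$ and relation $gr(\cdot\subseteq\cdot)$; and $J_g(f)=(f,f^{-1})$.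
   Formalization: Fuzzy topological spaces are taken to have a nonempty underlying set, because systems are required to be nonempty and J_g of the empty space would not be a graded fuzzy topological system. *)

(* Defs.v *)
From HB Require Import structures.
From mathcomp Require Import all_boot all_order all_algebra.
From mathcomp Require Import boolp classical_sets interval_inference reals.

Set Implicit Arguments.
Unset Strict Implicit.
Unset Printing Implicit Defensive.

Import Order.TTheory GRing.Theory Num.Theory.
Local Open Scope classical_set_scope.
Local Open Scope ring_scope.
Local Obligation Tactic := idtac.

Record category := Category {
  obj :> Type;
  hom : obj -> obj -> Type;
  idm : forall a, hom a a;
  comp : forall a b c, hom b c -> hom a b -> hom a c;
  comp_idl : forall a b (f : hom a b), comp (idm b) f = f;
  comp_idr : forall a b (f : hom a b), comp f (idm a) = f;
  comp_assoc : forall a b c d (h : hom c d) (g : hom b c) (f : hom a b),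
    comp h (comp g f) = comp (comp h g) f }.

Record functor (C D : category) := Functor {
  fobj :> C -> D;
  fmap : forall a b : C, hom a b -> hom (fobj a) (fobj b);
  fmap_id : forall a : C, fmap (idm a) = idm (fobj a);
  fmap_comp : forall (a b c : C) (g : hom b c) (f : hom a b),
    fmap (comp g f) = comp (fmap g) (fmap f) }.

(* A bijection hom (F c) d ~ hom c (G d), natural in c and in d. *)
Definition right_adjoint (C D : category) (G : functor D C) (F : functor C D)
    : Prop :=
  exists phi : forall (c : C) (d : D), hom (F c) d -> hom c (G d),
  [/\ forall c d, bijective (phi c d),
      forall c c' d (h : hom c' c) (k : hom (F c) d),
        phi c' d (comp k (fmap F h)) = comp (phi c d k) h
    & forall c d d' (g : hom d d') (k : hom (F c) d),
        phi c d' (comp g k) = comp (fmap G g) (phi c d k)].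

Section Grades.
Variable R : realType.
Implicit Types (a b c : {i01 R}) (S : set {i01 R}).

Lemma has_ubound_grades S : has_ubound [set a%:num | a in S].
Proof. by exists 1 => _ [a _ <-]; exact: le1. Qed.

Lemma has_lbound_grades S : has_lbound (1 |` [set a%:num | a in S]).
Proof. by exists 0 => _ [->|[a _ <-]]; [exact: ler01|exact: ge0]. Qed.

Lemma sup_grades_ge0 S : 0 <= sup [set a%:num | a in S].
Proof.
have [->|/set0P[a Sa]] := eqVneq S set0; first by rewrite image_set0 sup0.
apply: (@le_trans _ _ a%:num); first exact: ge0.
by apply: ub_le_sup; [exact: has_ubound_grades|exists a].
Qed.

Lemma sup_grades_le1 S : sup [set a%:num | a in S] <= 1.
Proof.
have [->|/set0P[a Sa]] := eqVneq S set0; first by rewrite image_set0 sup0.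
by apply: ge_sup; [exists a%:num, a|move=> _ [b _ <-]; exact: le1].
Qed.

Lemma inf_grades_ge0 S : 0 <= inf (1 |` [set a%:num | a in S]).
Proof.
apply: lb_le_inf; first by exists 1; left.
by move=> _ [->|[a _ <-]]; [exact: ler01|exact: ge0].
Qed.

Lemma inf_grades_le1 S : inf (1 |` [set a%:num | a in S]) <= 1.
Proof. by apply: ge_inf; [exact: has_lbound_grades|left]. Qed.

(* Supremum and infimum in the lattice [0,1].  In the reals sup set0 = 0 is
   already the least grade, but inf set0 = 0 is not the greatest one, whence
   the added 1. *)
Definition sup01 S : {i01 R} := Itv01 (sup_grades_ge0 S) (sup_grades_le1 S).
Definition inf01 S : {i01 R} := Itv01 (inf_grades_ge0 S) (inf_grades_le1 S).

Definition godel a b : {i01 R} := if a <= b then 1%:i01 else b.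

Lemma grade_le1 a : a <= 1%:i01.
Proof. by rewrite -num_le; exact: le1. Qed.

Lemma grade_ge0 a : 0%:i01 <= a.
Proof. by rewrite -num_le; exact: ge0. Qed.

Lemma sup01P S c : (sup01 S <= c) <-> (forall a, S a -> a <= c).
Proof.
rewrite -num_le; split=> [h a Sa|h].
  rewrite -num_le; apply: le_trans h.
  by apply: ub_le_sup; [exact: has_ubound_grades|exists a].
rewrite /sup01 /=.
have [->|/set0P[a Sa]] := eqVneq S set0; first by rewrite image_set0 sup0 ge0.
by apply: ge_sup; [exists a%:num, a|move=> _ [b /h hb <-]; rewrite num_le].
Qed.

Lemma inf01P S c : (c <= inf01 S) <-> (forall a, S a -> c <= a).
Proof.
rewrite -num_le; split=> [h a Sa|h].
  rewrite -num_le; apply: (le_trans h).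
  by apply: ge_inf; [exact: has_lbound_grades|right; exists a].
apply: lb_le_inf; first by exists 1; left.
by move=> _ [->|[a Sa <-]]; [exact: le1|rewrite num_le; exact: h].
Qed.

Lemma sup01_ub S a : S a -> a <= sup01 S.
Proof. by move=> Sa; apply: (sup01P S _).1 Sa. Qed.

Lemma inf01_lb S a : S a -> inf01 S <= a.
Proof. by move=> Sa; apply: (inf01P S _).1 Sa. Qed.

Lemma godelP a b c : (c <= godel a b) = (Order.min c a <= b).
Proof.
rewrite /godel ge_min; case: ifP => _; last by rewrite orbF.
by rewrite orbT grade_le1.
Qed.

Lemma grade_leP a b : (forall c, c <= a <-> c <= b) -> a = b.
Proof.
by move=> h; apply/eqP; rewrite eq_le (h a).1 //= (h b).2.
Qed.

Lemma grade_eq1 a : 1%:i01 <= a -> a = 1%:i01.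
Proof. by move=> h; apply/eqP; rewrite eq_le h grade_le1. Qed.

Lemma godel_eq1 a b : godel a b = 1%:i01 -> a <= b.
Proof.
move=> h; have : 1%:i01 <= godel a b by rewrite h.
by rewrite godelP min_r // grade_le1.
Qed.

End Grades.

Section FuzzySets.
Variable R : realType.

Definition fuzzy_set (X : Type) := X -> {i01 R}.

Section Operations.
Variable X : Type.

Definition fempty : fuzzy_set X := fun=> 0%:i01.
Definition ftotal : fuzzy_set X := fun=> 1%:i01.
Definition fcap (T1 T2 : fuzzy_set X) : fuzzy_set X :=
  fun x => Order.min (T1 x) (T2 x).
Definition fbigcup (F : set (fuzzy_set X)) : fuzzy_set X :=
  fun x => sup01 [set T x | T in F].
Definition fincl (T1 T2 : fuzzy_set X) : {i01 R} :=
  inf01 [set godel (T1 x) (T2 x) | x in setT].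

Lemma finclP (T1 T2 : fuzzy_set X) c :
  c <= fincl T1 T2 <-> (forall x, Order.min c (T1 x) <= T2 x).
Proof.
rewrite inf01P; split=> [h x|h _ [x _ <-]]; last by rewrite godelP.
by rewrite -godelP; apply: h; exists x.
Qed.

Lemma fincl1 (T1 T2 : fuzzy_set X) :
  fincl T1 T2 = 1%:i01 <-> (forall x, T1 x <= T2 x).
Proof.
split=> [h x|h].
  have : 1%:i01 <= fincl T1 T2 by rewrite h.
  by move=> /finclP /(_ x); rewrite min_r // grade_le1.
by apply/grade_eq1/finclP => x; rewrite min_r // grade_le1.
Qed.

End Operations.
End FuzzySets.
Arguments fempty {R X}.
Arguments ftotal {R X}.

(* Carriers of systems are required to be nonempty, so the functor J_g from
   spaces to systems only makes sense for spaces with a nonempty carrier. *)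
Record fuzzy_space (R : realType) := FuzzySpace {
  space_pt :> Type;
  space_inh : inhabited space_pt;
  tau : set (fuzzy_set R space_pt);
  tau_empty : tau fempty;
  tau_total : tau ftotal;
  tau_bigcup : forall F, F `<=` tau -> tau (fbigcup F);
  tau_cap : forall T1 T2, tau T1 -> tau T2 -> tau (fcap T1 T2) }.

Record continuous_map (R : realType) (X Y : fuzzy_space R) := ContinuousMap {
  cont_fun :> X -> Y;
  cont_preimage : forall T : fuzzy_set R Y, tau T -> tau (T \o cont_fun) }.

Record graded_frame (R : realType) := GradedFrame {
  frame_elt :> Type;
  ftop : frame_elt;
  fmeet : frame_elt -> frame_elt -> frame_elt;
  fjoin : set frame_elt -> frame_elt;
  frel : frame_elt -> frame_elt -> {i01 R};
  frel_refl : forall a, frel a a = 1%:i01;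
  frel_anti : forall a b, frel a b = 1%:i01 -> frel b a = 1%:i01 -> a = b;
  frel_trans : forall a b c, Order.min (frel a b) (frel b c) <= frel a c;
  fmeet_l : forall a b, frel (fmeet a b) a = 1%:i01;
  fmeet_r : forall a b, frel (fmeet a b) b = 1%:i01;
  frel_top : forall a, frel a ftop = 1%:i01;
  frel_meet : forall a b c,
    Order.min (frel a b) (frel a c) = frel a (fmeet b c);
  fjoin_ub : forall S a, S a -> frel a (fjoin S) = 1%:i01;
  frel_join : forall S b,
    inf01 [set frel a b | a in S] = frel (fjoin S) b;
  fmeet_join : forall S a,
    frel (fmeet a (fjoin S)) (fjoin [set fmeet a b | b in S]) = 1%:i01 }.

(* Preservation of the top element is not required. *)
Record frame_hom (R : realType) (A B : graded_frame R) := FrameHom {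
  frame_fun :> A -> B;
  frame_fun_meet : forall a1 a2,
    frame_fun (fmeet a1 a2) = fmeet (frame_fun a1) (frame_fun a2);
  frame_fun_join : forall S : set A,
    frame_fun (fjoin S) = fjoin [set frame_fun a | a in S];
  frame_fun_rel : forall a1 a2,
    frel a1 a2 <= frel (frame_fun a1) (frame_fun a2) }.

(* Finite subsets are given by finite families s, possibly with repetitions;
   n = 0 gives the empty one, whose meet is the top element. *)
Record fuzzy_system (R : realType) := FuzzySystem {
  sys_pt :> Type;
  sys_inh : inhabited sys_pt;
  sys_frame : graded_frame R;
  sat : sys_pt -> sys_frame -> {i01 R};
  sat_rel : forall x a b, Order.min (sat x a) (frel a b) <= sat x b;
  sat_meet : forall x n (s : 'I_n -> sys_frame),
    sat x (\big[@fmeet R sys_frame/ftop sys_frame]_(i < n) s i) =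
    inf01 [set sat x (s i) | i in setT];
  sat_join : forall x (S : set sys_frame),
    sat x (fjoin S) = sup01 [set sat x a | a in S] }.

Record system_hom (R : realType) (P Q : fuzzy_system R) := SystemHom {
  pt_map : P -> Q;
  fr_map : frame_hom (sys_frame Q) (sys_frame P);
  sat_map : forall x b, sat x (fr_map b) = sat (pt_map x) b }.

Section Categories.
Variable R : realType.

Lemma continuous_map_eq (X Y : fuzzy_space R) (f g : continuous_map X Y) :
  cont_fun f = cont_fun g -> f = g.
Proof.
case: f g => [f hf] [g hg] /= e; subst g.
by congr ContinuousMap; exact: Prop_irrelevance.
Qed.

Lemma frame_hom_eq (A B : graded_frame R) (f g : frame_hom A B) :
  frame_fun f = frame_fun g -> f = g.
Proof.
case: f g => [f f1 f2 f3] [g g1 g2 g3] /= e; subst g.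
by congr FrameHom; exact: Prop_irrelevance.
Qed.

Lemma system_hom_eq (P Q : fuzzy_system R) (f g : system_hom P Q) :
  pt_map f = pt_map g -> frame_fun (fr_map f) = frame_fun (fr_map g) -> f = g.
Proof.
case: f g => [f f' hf] [g g' hg] /= e /frame_hom_eq e'; subst g g'.
by congr SystemHom; exact: Prop_irrelevance.
Qed.

Definition continuous_id (X : fuzzy_space R) : continuous_map X X :=
  @ContinuousMap R X X id (fun T hT => hT).

Definition continuous_comp (X Y Z : fuzzy_space R)
    (g : continuous_map Y Z) (f : continuous_map X Y) : continuous_map X Z :=
  @ContinuousMap R X Z (g \o f)
    (fun T hT => cont_preimage f (cont_preimage g hT)).

Program Definition graded_fuzzy_top : category :=
  @Category (fuzzy_space R) (@continuous_map R)
    continuous_id continuous_comp _ _ _.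
Next Obligation. by move=> *; apply: continuous_map_eq. Qed.
Next Obligation. by move=> *; apply: continuous_map_eq. Qed.
Next Obligation. by move=> *; apply: continuous_map_eq. Qed.

Program Definition frame_id (A : graded_frame R) : frame_hom A A :=
  @FrameHom R A A id _ _ _.
Next Obligation. by []. Qed.
Next Obligation. by move=> A S; rewrite image_id. Qed.
Next Obligation. by []. Qed.

Program Definition frame_comp (A B C : graded_frame R)
    (g : frame_hom B C) (f : frame_hom A B) : frame_hom A C :=
  @FrameHom R A C (g \o f) _ _ _.
Next Obligation. by move=> *; rewrite /= !frame_fun_meet. Qed.
Next Obligation. by move=> *; rewrite /= !frame_fun_join image_comp. Qed.
Next Obligation.
move=> A B C g f a1 a2; apply: (le_trans (frame_fun_rel f a1 a2)).
exact: frame_fun_rel.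
Qed.

Definition system_id (P : fuzzy_system R) : system_hom P P :=
  @SystemHom R P P id (frame_id (sys_frame P)) (fun x b => erefl).

Program Definition system_comp (P Q W : fuzzy_system R)
    (g : system_hom Q W) (f : system_hom P Q) : system_hom P W :=
  @SystemHom R P W (pt_map g \o pt_map f) (frame_comp (fr_map f) (fr_map g)) _.
Next Obligation. by move=> *; rewrite /= !sat_map. Qed.

Program Definition graded_fuzzy_topsys : category :=
  @Category (fuzzy_system R) (@system_hom R) system_id system_comp _ _ _.
Next Obligation. by move=> *; apply: system_hom_eq. Qed.
Next Obligation. by move=> *; apply: system_hom_eq. Qed.
Next Obligation. by move=> *; apply: system_hom_eq. Qed.

End Categories.

Section ExtFunctor.
Variable R : realType.

Definition ext_g (P : fuzzy_system R) (a : sys_frame P) : fuzzy_set R P :=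
  fun x => sat x a.

Lemma ext_g_top (P : fuzzy_system R) : ext_g (ftop (sys_frame P)) = ftotal.
Proof.
apply/funext => x; apply: grade_eq1; rewrite /ext_g.
have := sat_meet x (fun i : 'I_0 => ftop (sys_frame P)).
by rewrite big_ord0 => ->; apply/inf01P => _ [i _ <-]; case: i.
Qed.

Lemma ext_g_meet (P : fuzzy_system R) (a b : sys_frame P) :
  ext_g (fmeet a b) = fcap (ext_g a) (ext_g b).
Proof.
apply/funext => x; rewrite /ext_g /fcap.
have meet_top (c : sys_frame P) : fmeet c (ftop _) = c.
  apply: frel_anti; first exact: fmeet_l.
  by rewrite -frel_meet frel_refl frel_top minxx.
have := sat_meet x (fun i : 'I_2 => if i == ord0 then a else b).
rewrite !big_ord_recl big_ord0 /= meet_top => ->.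
apply: grade_leP => c; rewrite inf01P le_min; split=> [h|/andP[ha hb] _ [i _ <-]].
  by rewrite (h (sat x a)) ?(h (sat x b)) //; [exists ord_max|exists ord0].
by case: ifP.
Qed.

Lemma ext_g_join (P : fuzzy_system R) (S : set (sys_frame P)) :
  ext_g (fjoin S) = fbigcup [set ext_g a | a in S].
Proof.
by apply/funext => x; rewrite /ext_g sat_join /fbigcup image_comp.
Qed.

Program Definition Ext_g_obj (P : fuzzy_system R) : fuzzy_space R :=
  @FuzzySpace R P (sys_inh P) [set ext_g a | a in setT] _ _ _ _.
Next Obligation.
move=> P; exists (fjoin set0) => //; rewrite ext_g_join image_set0.
apply/funext => x; apply/eqP; rewrite eq_le grade_ge0 andbT.
by apply/sup01P => _ [_ [] _].
Qed.
Next Obligation. by move=> P; exists (ftop _) => //; exact: ext_g_top. Qed.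
Next Obligation.
move=> P F FE; exists (fjoin [set a | F (ext_g a)]) => //.
rewrite ext_g_join; congr fbigcup; apply/seteqP; split=> [_ [a Fa <-]//|T FT].
by have [a _ ea] := FE _ FT; exists a; rewrite //= ea.
Qed.
Next Obligation.
by move=> P _ _ [a _ <-] [b _ <-]; exists (fmeet a b) => //; exact: ext_g_meet.
Qed.

Program Definition Ext_g_hom (P Q : fuzzy_system R) (f : system_hom P Q) :
    continuous_map (Ext_g_obj P) (Ext_g_obj Q) :=
  @ContinuousMap R (Ext_g_obj P) (Ext_g_obj Q) (pt_map f) _.
Next Obligation.
move=> P Q f _ [b _ <-]; exists (fr_map f b) => //.
by apply/funext => x; exact: sat_map.
Qed.

Program Definition Ext_g :
    functor (graded_fuzzy_topsys R) (graded_fuzzy_top R) :=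
  @Functor (graded_fuzzy_topsys R) (graded_fuzzy_top R)
    Ext_g_obj Ext_g_hom _ _.
Next Obligation. by move=> *; apply: continuous_map_eq. Qed.
Next Obligation. by move=> *; apply: continuous_map_eq. Qed.

End ExtFunctor.

Section JFunctor.
Variable R : realType.

Section Frame.
Variable X : fuzzy_space R.
Implicit Types (a b c : set_type (@tau R X)) (S : set (set_type (@tau R X))).

Definition open_of (T : fuzzy_set R X) (hT : tau T) : set_type (@tau R X) :=
  exist _ T (mem_set hT).

Lemma tau_val a : tau (val a). Proof. exact: set_valP. Qed.

Lemma tau_bigcup_val S : tau (fbigcup [set val a | a in S]).
Proof. by apply: tau_bigcup => _ [a _ <-]; exact: tau_val. Qed.

Definition opens_top := open_of (tau_total X).
Definition opens_meet a b := open_of (tau_cap (tau_val a) (tau_val b)).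
Definition opens_join S := open_of (tau_bigcup_val S).
Definition opens_rel a b := fincl (val a) (val b).

Lemma opens_join_ub S a : S a -> forall x, val a x <= val (opens_join S) x.
Proof. by move=> Sa x; apply: sup01_ub; exists (val a) => //; exists a. Qed.

Lemma opens_joinP S x (c : {i01 R}) :
  val (opens_join S) x <= c <-> (forall a, S a -> val a x <= c).
Proof.
split=> [h a Sa|h]; first exact: le_trans (opens_join_ub Sa x) h.
by apply/sup01P => _ [_ [a Sa <-] <-]; exact: h.
Qed.

Program Definition opens_frame : graded_frame R :=
  @GradedFrame R (set_type (@tau R X))
    opens_top opens_meet opens_join opens_rel _ _ _ _ _ _ _ _ _ _.
Next Obligation. by move=> a; apply/fincl1. Qed.
Next Obligation.
move=> a b /fincl1 ab /fincl1 ba; apply: val_inj; apply/funext => x.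
by apply/eqP; rewrite eq_le ab ba.
Qed.
Next Obligation.
move=> a b c; apply/finclP => x.
set p := opens_rel a b; set q := opens_rel b c.
have pP : p <= fincl (val a) (val b) by [].
have qP : q <= fincl (val b) (val c) by [].
apply: le_trans ((finclP _ _ _).1 qP x).
rewrite le_min; apply/andP; split; first by rewrite !ge_min lexx orbT.
apply: le_trans ((finclP _ _ _).1 pP x).
by rewrite le_min !ge_min !lexx ?orbT.
Qed.
Next Obligation. by move=> a b; apply/fincl1 => x; rewrite ge_min lexx. Qed.
Next Obligation. by move=> a b; apply/fincl1 => x; rewrite ge_min lexx orbT. Qed.
Next Obligation. by move=> a; apply/fincl1 => x; exact: grade_le1. Qed.
Next Obligation.
move=> a b c; apply: grade_leP => r; rewrite le_min finclP.
split=> [/andP[/finclP hb /finclP hc] x|h].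
  by rewrite le_min hb hc.
by apply/andP; split; apply/finclP => x; have := h x; rewrite le_min => /andP[].
Qed.
Next Obligation. by move=> S a Sa; apply/fincl1; exact: opens_join_ub. Qed.
Next Obligation.
move=> S b; apply: grade_leP => r; rewrite inf01P finclP; split=> [h x|h _ [a Sa <-]].
  rewrite minC -godelP; apply/opens_joinP => a Sa; rewrite godelP minC.
  by apply/finclP: x; apply: h; exists a.
apply/finclP => x; apply: le_trans (h x).
by rewrite le_min !ge_min lexx (opens_join_ub Sa) orbT.
Qed.
Next Obligation.
move=> S a; apply/fincl1 => x; rewrite /= {1}/fcap minC -godelP.
apply/opens_joinP => b Sb; rewrite godelP minC.
by apply: (@opens_join_ub _ (opens_meet a b)); exists b.
Qed.

Lemma opens_bigmeetP x n (s : 'I_n -> set_type (@tau R X)) (c : {i01 R}) :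
  c <= val (\big[opens_meet/opens_top]_(i < n) s i) x <->
  (forall i, c <= val (s i) x).
Proof.
elim: n s => [|n IHn] s; first by rewrite big_ord0; split=> [_ []//|_]; exact: grade_le1.
rewrite big_ord_recl /= /fcap le_min; split=> [/andP[h0 /IHn h] i|h].
  by have [j ->|->] := unliftP ord0 i; [exact: h|exact: h0].
by apply/andP; split; [exact: h|apply/IHn => i; exact: h].
Qed.

End Frame.

Program Definition J_g_obj (X : fuzzy_space R) : fuzzy_system R :=
  @FuzzySystem R X (space_inh X) (opens_frame X)
    (fun x (T : set_type (@tau R X)) => val T x) _ _ _.
Next Obligation.
move=> X x a b; rewrite minC; exact: (finclP _ _ _).1 (lexx (opens_rel a b)) x.
Qed.
Next Obligation.
move=> X x n s; apply: grade_leP => c.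
rewrite (opens_bigmeetP x s) inf01P.
by split=> [h _ [i _ <-]//|h i]; apply: h; exists i.
Qed.
Next Obligation. by move=> X x S; rewrite /= /fbigcup image_comp. Qed.

Program Definition preimage_hom (X Y : fuzzy_space R) (f : continuous_map X Y) :
    frame_hom (opens_frame Y) (opens_frame X) :=
  @FrameHom R (opens_frame Y) (opens_frame X)
    (fun T : set_type (@tau R Y) => open_of (cont_preimage f (tau_val T))) _ _ _.
Next Obligation. by move=> X Y f a b; apply: val_inj. Qed.
Next Obligation.
move=> X Y f S; apply: val_inj; apply/funext => x /=.
by rewrite /fbigcup !image_comp.
Qed.
Next Obligation.
move=> X Y f a b; apply/finclP => x.
exact: (finclP _ _ _).1 (lexx (opens_rel a b)) (f x).
Qed.

Definition J_g_hom (X Y : fuzzy_space R) (f : continuous_map X Y) :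
    system_hom (J_g_obj X) (J_g_obj Y) :=
  @SystemHom R (J_g_obj X) (J_g_obj Y) f (preimage_hom f)
    (fun x b => erefl).

Program Definition J_g :
    functor (graded_fuzzy_top R) (graded_fuzzy_topsys R) :=
  @Functor (graded_fuzzy_top R) (graded_fuzzy_topsys R) J_g_obj J_g_hom _ _.
Next Obligation.
move=> X; apply: system_hom_eq => //; apply/funext => T; exact: val_inj.
Qed.
Next Obligation.
move=> X Y Z g f; apply: system_hom_eq => //; apply/funext => T; exact: val_inj.
Qed.

End JFunctor.

(* Main.v *)
(* A map from J_g X to a system P is determined by its map f on points, because
   the satisfaction condition forces a to go to the open set sat (f x) a of x;
   and this assignment takes values in the opens of X exactly when f is
   continuous from X to Ext_g P. *)
Require Import Defs.
From mathcomp Require Import all_boot all_order all_algebra reals.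
From mathcomp Require Import boolp classical_sets interval_inference.

Import Order.TTheory.
Local Open Scope classical_set_scope.
Local Open Scope ring_scope.

Section Transpose.
Variables (R : realType) (X : fuzzy_space R) (P : fuzzy_system R).

(** Every open of [Ext_g_obj P] is some [ext_g a], and [sat_map] identifies its preimage with the
    open [fr_map k a]. *)
Lemma pt_map_preimage (k : system_hom (J_g_obj X) P)
    (T : fuzzy_set R (Ext_g_obj P)) : tau T -> tau (T \o pt_map k).
Proof.
move=> [a _ <-].
have -> : ext_g a \o pt_map k = val (fr_map k a).
  by apply/funext => x; rewrite /= /ext_g -sat_map.
exact: tau_val.
Qed.

Definition transpose (k : system_hom (J_g_obj X) P) :
    continuous_map X (Ext_g_obj P) :=
  @ContinuousMap R X (Ext_g_obj P) (pt_map k) (pt_map_preimage k).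

Section Untranspose.
Variable f : continuous_map X (Ext_g_obj P).

Lemma tau_ext_preimage (a : sys_frame P) : tau (ext_g a \o f).
Proof. by apply: (cont_preimage f); exists a. Qed.

Definition ext_preimage (a : sys_frame P) : opens_frame X :=
  open_of (tau_ext_preimage a).

Lemma ext_preimage_meet a b :
  ext_preimage (fmeet a b) = fmeet (ext_preimage a) (ext_preimage b).
Proof. by apply: val_inj; rewrite /= ext_g_meet. Qed.

Lemma ext_preimage_join S :
  ext_preimage (fjoin S) = fjoin [set ext_preimage a | a in S].
Proof.
apply: val_inj; apply/funext => x /=.
by rewrite ext_g_join /fbigcup !image_comp.
Qed.

(** Since minimum is residuated by the Gödel arrow, the bound reduces at each point [x] to [sat_rel]
    at [f x]. *)
Lemma ext_preimage_rel a b :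
  Defs.frel a b <= Defs.frel (ext_preimage a) (ext_preimage b).
Proof. by apply/finclP => x; rewrite minC; exact: sat_rel. Qed.

Definition ext_preimage_hom : frame_hom (sys_frame P) (opens_frame X) :=
  @FrameHom R (sys_frame P) (opens_frame X) ext_preimage
    ext_preimage_meet ext_preimage_join ext_preimage_rel.

Definition untranspose : system_hom (J_g_obj X) P :=
  @SystemHom R (J_g_obj X) P f ext_preimage_hom (fun x b => erefl).

End Untranspose.

(** The point map is untouched, and [sat_map] recovers the open [fr_map k a] from it pointwise. *)
Lemma transposeK : cancel transpose untranspose.
Proof.
move=> k; apply: system_hom_eq => //; apply/funext => a; apply: val_inj.
by apply/funext => x; rewrite /= /ext_g -sat_map.
Qed.

Lemma untransposeK : cancel untranspose transpose.
Proof. by move=> f; exact: continuous_map_eq. Qed.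

End Transpose.

Theorem lemma2p7 (R : realType) : right_adjoint (Ext_g R) (J_g R).
Proof.
exists (@transpose R); split.
- move=> X P; exists (@untranspose R X P);
  [exact: transposeK|exact: untransposeK].
(* Both naturality squares commute because [transpose], [J_g] and [Ext_g] all keep the point map. *)
- by move=> X X' P h k; exact: continuous_map_eq.
- by move=> X P P' g k; exact: continuous_map_eq.
Qed.
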